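(* Let $\mathcal{F}$ and $\mathcal{S}$ be two orthogonal Fano planes on a common point-set. Then the group $\operatorname{Aut}(\mathcal{F})\cap\operatorname{Aut}(\mathcal{S})$ of their common automorphisms is isomorphic to the Frobenius group $F_{21}$ of order $21$ (the unique non-abelian group of order 21).
   Context: A Steiner triple system STS$(v)$ is a pair $(\mathcal{V},\mathcal{B})$ with $|\mathcal{V}|=v$ and $\mathcal{B}$ a collection of 3-subsets of $\mathcal{V}$ (blocks) such that every 2-subset of $\mathcal{V}$ lies in exactly one block. A Fano plane is an STS$(7)$. An automorphism of an STS is a permutation $\sigma$ of $\mathcal{V}$ with $T\in\mathcal{B}$ iff $\sigma(T)\in\mathcal{B}$. Two STSs $(\mathcal{V},\mathcal{B}_1)$, $(\mathcal{V},\mathcal{B}_2)$ on the same point-set are orthogonal if $\mathcal{B}_1\cap\mathcal{B}_2=\emptyset$ and, whenever $\{x,y,z\},\{u,v,z\}\in\mathcal{B}_1$ and $\{x,y,a\},\{u,v,b\}\in\mathcal{B}_2$, we have $a\neq b$. For Fano planes, orthogonality is equivalent to having no block in common. *)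

(* Defs.v *)
From mathcomp Require Import all_boot all_order all_fingroup all_algebra.

Set Implicit Arguments.
Unset Strict Implicit.
Unset Printing Implicit Defensive.

Import GRing.Theory.

Definition steiner_triple_system (V : finType) (v : nat) (B : {set {set V}}) : Prop :=
  [/\ #|V| = v,
      (forall T : {set V}, T \in B -> #|T| = 3)
    & (forall P : {set V}, #|P| = 2 ->
         exists! T : {set V}, T \in B /\ P \subset T)].

Definition fano_plane (V : finType) (B : {set {set V}}) : Prop :=
  steiner_triple_system 7 B.

(* {x, y, z} and {u, v, z} are meant to be two different blocks: if they could
   coincide, then x = u, y = v, a = b would make the condition unsatisfiable. *)
Definition orthogonal_sts (V : finType) (B1 B2 : {set {set V}}) : Prop :=
  B1 :&: B2 = set0 /\
  (forall x y z u v a b : V,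
     [set x; y; z] != [set u; v; z] ->
     [set x; y; z] \in B1 -> [set u; v; z] \in B1 ->
     [set x; y; a] \in B2 -> [set u; v; b] \in B2 ->
     a != b).

Section StsAut.

Variables (V : finType) (B : {set {set V}}).

Definition sts_aut : {set {perm V}} :=
  [set s : {perm V} | [forall T : {set V}, (T \in B) == ([set s x | x in T] \in B)]].

Lemma sts_autP (s : {perm V}) :
  reflect (forall T : {set V}, T \in B <-> [set s x | x in T] \in B)
          (s \in sts_aut).
Proof.
rewrite inE; apply: (iffP forallP) => [h T|h T]; first by rewrite -(eqP (h T)).
by apply/eqP; apply/idP/idP; case: (h T).
Qed.

Lemma sts_aut_group_set : group_set sts_aut.
Proof.
apply/group_setP; split=> [|s t /sts_autP hs /sts_autP ht]; apply/sts_autP => T.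
  suff -> : [set (1%g : {perm V}) x | x in T] = T by [].
  by rewrite -[RHS]imset_id; apply: eq_imset => x; rewrite perm1.
suff -> : [set (s * t)%g x | x in T] = [set t x | x in [set s x | x in T]].
  exact: iff_trans (hs T) (ht _).
by rewrite -imset_comp; apply: eq_imset => x; rewrite permM.
Qed.

Canonical sts_aut_group := Group sts_aut_group_set.

End StsAut.

Section F21.

Local Open Scope ring_scope.

(* The Frobenius group C_7 : C_3, realised as the affine maps x |-> a x + b
   of the field 'F_7 whose slope a lies in the order 3 subgroup of the units. *)
Definition F21 : {set {perm 'F_7}} :=
  [set s : {perm 'F_7} | [exists a : 'F_7, exists b : 'F_7,
     (a ^+ 3 == 1) && [forall x : 'F_7, s x == a * x + b]]].

Lemma F21P (s : {perm 'F_7}) :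
  reflect (exists a b : 'F_7, a ^+ 3 = 1 /\ forall x, s x = a * x + b)
          (s \in F21).
Proof.
rewrite inE; apply: (iffP existsP).
  case=> a /existsP[b /andP[/eqP a3 /forallP h]].
  by exists a, b; split=> // x; apply/eqP.
case=> a [b [a3 h]]; exists a; apply/existsP; exists b.
by rewrite a3 eqxx; apply/forallP => x; rewrite h.
Qed.

Lemma F21_group_set : group_set F21.
Proof.
apply/group_setP; split=> [|s t]; first apply/F21P.
  by exists 1, 0; split=> [|x]; rewrite ?expr1n // perm1 mul1r addr0.
case/F21P=> a [b [a3 sE]] /F21P[c [d [c3 tE]]]; apply/F21P.
exists (c * a), (c * b + d); split=> [|x]; first by rewrite exprMn c3 a3 mulr1.
by rewrite permM sE tE mulrDr mulrA addrA.
Qed.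

Canonical F21_group := Group F21_group_set.

Lemma affine_inj (a b : 'F_7) : a ^+ 3 = 1 -> injective (fun x : 'F_7 => a * x + b).
Proof.
move=> a3 x y /addIr; apply: mulfI; apply/eqP => a0.
by move/eqP: a3; rewrite a0 expr0n eq_sym oner_eq0.
Qed.

Lemma card_F21 : #|F21| = 21%N.
Proof.
pose D := [set p : 'F_7 * 'F_7 | p.1 ^+ 3 == 1].
pose g (s : {perm 'F_7}) : 'F_7 * 'F_7 := (s 1 - s 0, s 0).
have gE (s : {perm 'F_7}) (a b : 'F_7) : (forall x, s x = a * x + b) -> g s = (a, b).
  by move=> h; rewrite /g !h mulr0 mulr1 add0r addrK.
have gi : {in F21 &, injective g}.
  move=> s t /F21P[a [b [_ sE]]] /F21P[c [d [_ tE]]].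
  rewrite (gE _ _ _ sE) (gE _ _ _ tE) => -[ac bd].
  by apply/permP => x; rewrite sE tE ac bd.
rewrite -(card_in_imset gi).
have -> : g @: F21 = D.
  apply/setP => -[a b]; rewrite inE /=; apply/imsetP/eqP.
    by case=> s /F21P[c [d [c3 sE]]]; rewrite (gE _ _ _ sE) => -[-> _].
  move=> a3; pose s := perm (@affine_inj a b a3).
  have sE x : s x = a * x + b by rewrite permE.
  by exists s; [apply/F21P; exists a, b | rewrite (gE _ _ _ sE)].
have -> : D = setX [set a : 'F_7 | a ^+ 3 == 1] [set: 'F_7].
  by apply/setP => -[a b]; rewrite !inE andbT.
rewrite cardsX cardsT card_Fp //.
have -> : [set a : 'F_7 | a ^+ 3 == 1] = [set 1; 2%:R; 4%:R].
  by apply/setP => -[[|[|[|[|[|[|[|m]]]]]]] hm]; rewrite !inE.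
by rewrite -setUA !cardsU1 cards1 !inE.
Qed.

Lemma F21_nonabelian : ~~ abelian F21.
Proof.
have h2 : (2%:R : 'F_7) ^+ 3 = 1 by apply/val_inj.
pose s := perm (@affine_inj _ 0 h2); pose t := perm (@affine_inj _ 1 (expr1n _ 3)).
have sE x : s x = 2%:R * x + 0 by rewrite permE.
have tE x : t x = 1 * x + 1 by rewrite permE.
have sF : s \in F21 by apply/F21P; exists 2%:R, 0.
have tF : t \in F21 by apply/F21P; exists 1, 1; rewrite expr1n.
apply/negP => /centsP/(_ s sF t tF)/permP/(_ 0).
by rewrite !permM !sE !tE => /(congr1 val).
Qed.

End F21.

(* Main.v *)
(* Replace each system by its Steiner quasigroup: x o y is the third point of the
   block through x and y, and x o x = x.  Around a point p, each system pairs the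
   six other points; disjointness forces the two pairings to form a hexagon.
   Labelling p by 0 and the vertices of the hexagon by the successive powers of
   the primitive root 3 of 'F_7 (in the right direction) determines both systems:
   the operations become 4 (x + y) -+ (x - y)^4.  A permutation respecting both is
   determined by the images of 0 and 1, and it exists exactly when their
   difference is a cube root of unity, i.e. when it belongs to F21. *)
Require Import Defs.
From mathcomp Require Import all_boot all_order all_fingroup all_algebra.

Set Implicit Arguments.
Unset Strict Implicit.
Unset Printing Implicit Defensive.

Import GRing.Theory.
Local Open Scope ring_scope.

(** * Steiner quasigroups of triple systems *)

Definition steiner_op (T : Type) (f : T -> T -> T) : Prop :=
  [/\ idempotent_op f, commutative f & forall x y, f x (f x y) = y].

Definition third_point (V : finType) (B : {set {set V}}) (f : V -> V -> V) :=
  forall x y z, x != y -> ([set x; y; z] \in B) = (z == f x y).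

Lemma set3C (T : finType) (x y z : T) : [set x; y; z] = [set y; x; z].
Proof. by rewrite (setUC [set x]). Qed.

Lemma set3AC (T : finType) (x y z : T) : [set x; y; z] = [set x; z; y].
Proof. by rewrite setUAC. Qed.

Lemma set3_of_card (T : finType) (A : {set T}) : #|A| = 3%N ->
  exists x y z, [/\ x != y, x != z, y != z & A = [set x; y; z]].
Proof.
move=> A3; have [x xA] : exists x, x \in A by apply/card_gt0P; rewrite A3.
have /eqP/cards2P[y [z [yz Ax]]] : #|A :\ x| = 2%N.
  by move: A3; rewrite (cardsD1 x) xA => -[].
have /setD1P[yx _] : y \in A :\ x by rewrite Ax !inE eqxx.
have /setD1P[zx _] : z \in A :\ x by rewrite Ax !inE eqxx orbT.
exists x, y, z; split=> //; try by rewrite eq_sym.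
by rewrite -(setD1K xA) Ax setUA.
Qed.

Lemma sts_third_point (V : finType) (v : nat) (B : {set {set V}}) :
  steiner_triple_system v B -> exists f, steiner_op f /\ third_point B f.
Proof.
case=> _ B3 B2.
(* The value [x] on the diagonal makes the operation total and idempotent. *)
have ex x y : exists z, if x == y then z = x else [set x; y; z] \in B.
  case: (eqVneq x y) => [_|xy]; first by exists x.
  have := B2 [set x; y]; rewrite cards2 xy => /(_ erefl)[T [[TB sT] _]].
  have : #|T :\: [set x; y]| == 1%N.
    by rewrite cardsD (setIidPr sT) (B3 _ TB) cards2 xy.
  case/cards1P => z Tz; exists z.
  by rewrite -Tz -{1}(setIidPr sT) setID.
have [f fP] : exists f : V -> V -> V, forall x y,
    if x == y then f x y = x else [set x; y; f x y] \in B.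
  by have [f fP] := fin_all_exists (fun x => fin_all_exists (ex x)); exists f.
have fxx x : f x x = x by have := fP x x; rewrite eqxx.
have fB x y : x != y -> [set x; y; f x y] \in B.
  by move=> /negPf xy; have := fP x y; rewrite xy.
have distinct x y z : [set x; y; z] \in B -> z != x /\ z != y.
  move=> /B3 h; split; apply: contra_eqN h => /eqP->.
    by rewrite setUAC setUid cards2; case: (x != y).
  by rewrite -setUA setUid cards2; case: (x != y).
have fT : third_point B f.
  move=> x y z xy; apply/idP/eqP=> [zB|->]; last exact: fB.
  have := B2 [set x; y]; rewrite cards2 xy => /(_ erefl)[T [_ uT]].
  have := uT _ (conj (fB x y xy) (subsetUl _ _)).
  rewrite (uT _ (conj zB (subsetUl _ _))) => /setP/(_ z).
  have [zx zy] := distinct _ _ _ zB.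
  by rewrite !inE eqxx (negPf zx) (negPf zy) => /esym/eqP.
exists f; split=> //; split=> // x y; case: (eqVneq x y) => [->|xy] //.
- by apply/eqP; rewrite -fT 1?eq_sym // set3C fB.
- by rewrite !fxx.
apply/esym/eqP; have fxy := fB x y xy.
by rewrite -fT 1?set3AC // eq_sym; case: (distinct _ _ _ fxy).
Qed.

(** Off the diagonal the blocks are the graph of [f]; on it, idempotence makes the identity
    automatic. *)
Lemma sts_aut_third_point (V : finType) (v : nat) (B : {set {set V}}) f
    (s : {perm V}) :
  steiner_triple_system v B -> steiner_op f -> third_point B f ->
  s \in sts_aut B <-> forall x y, s (f x y) = f (s x) (s y).
Proof.
move=> [_ B3 _] [fxx _ _] fT.
have im3 x y z : [set s u | u in [set x; y; z]] = [set s x; s y; s z].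
  by rewrite !imsetU !imset_set1.
split=> [/sts_autP sB x y | sf].
  case: (eqVneq x y) => [->|xy]; first by rewrite !fxx.
  apply/eqP; rewrite -fT ?(inj_eq perm_inj) // -im3.
  by apply: (proj1 (sB _)); rewrite fT.
(* A permutation preserves cardinals, so a set that is not a triple lies outside [B] together with
   its image. *)
apply/sts_autP=> T; suff h : #|T| = 3%N -> (T \in B) = (s @: T \in B).
  split=> TB; first by rewrite -h // B3.
  by rewrite h // -(card_imset _ (@perm_inj _ s)) B3.
case/set3_of_card=> x [y [z [xy _ _ ->]]].
by rewrite im3 !fT ?(inj_eq perm_inj) // -sf (inj_eq perm_inj).
Qed.

Lemma steiner_op_inj (T : Type) (f : T -> T -> T) (x : T) :
  steiner_op f -> injective (f x).
Proof. by case=> _ _ fK; apply: can_inj (fK x). Qed.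

Lemma steiner_op_eql (T : eqType) (f : T -> T -> T) (x y : T) :
  steiner_op f -> (f x y == x) = (x == y).
Proof.
move=> fS; have [fxx _ _] := fS.
by rewrite -{2}(fxx x) (inj_eq (@steiner_op_inj _ _ x fS)) eq_sym.
Qed.

Lemma steiner_op_eqr (T : eqType) (f : T -> T -> T) (x y : T) :
  steiner_op f -> (f x y == y) = (x == y).
Proof. by move=> fS; have [_ fC _] := fS; rewrite fC steiner_op_eql // eq_sym. Qed.

(** Serves to transport an operation along a labelling by ['F_7], and along negation in ['F_7]. *)
Lemma steiner_op_conj (T U : Type) (c : T -> U) (d : U -> T) (f : U -> U -> U) :
  cancel c d -> cancel d c -> steiner_op f ->
  steiner_op (fun x y => d (f (c x) (c y))).
Proof.
move=> cK dK [fxx fC fK]; split=> [x|x y|x y].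
- by rewrite fxx cK.
- by rewrite fC.
- by rewrite dK fK cK.
Qed.

(* A product rather than a conjunction, so that it is a rewriting multirule. *)
Lemma steiner_op_block (T : Type) (f : T -> T -> T) (x y z : T) : steiner_op f ->
  f x y = z ->
  (((f x y = z) * (f y x = z)) * ((f x z = y) * (f z x = y))) *
  ((f y z = x) * (f z y = x)).
Proof.
move=> fS fxy; have [_ fC fK] := fS.
by rewrite -[f z y]fC -[f z x]fC -[f y x]fC -fxy fK [f x y]fC fK.
Qed.

(** * The hexagon around a point *)

(* The vertices of the hexagon around [c 0] are, in cyclic order, [c 1], [c 3],
   [c 2], [c 6], [c 4], [c 5]. *)
Definition hexagon (V : Type) (f g : V -> V -> V) (c : 'F_7 -> V) : Prop :=
  [/\ f (c 0) (c 1) = c 3, f (c 0) (c 2) = c 6 & f (c 0) (c 4) = c 5] /\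
  [/\ g (c 0) (c 3) = c 2, g (c 0) (c 6) = c 4 & g (c 0) (c 5) = c 1].

(** On the six points other than [p], [f p] and [g p] are fixed-point-free involutions that disagree
    everywhere. Alternating them from [a0] gives four distinct points up to [a3]. The two remaining
    points are swapped by [f p], so [g p] can only join them to [a0] and [a3], which closes the
    hexagon. *)
Lemma steiner_hexagon (V : finType) (f g : V -> V -> V) :
  #|V| = 7%N -> steiner_op f -> steiner_op g ->
  (forall x y, x != y -> f x y != g x y) ->
  exists2 c, bijective c & hexagon f g c.
Proof.
move=> V7 fS gS fg.
have [p [a0 pa0]] : exists p a0 : V, p != a0.
  have /card_gt1P[p [a [_ _ pa]]] : (1 < #|V|)%N by rewrite V7.
  by exists p, a.
pose a1 := f p a0; pose a2 := g p a1; pose a3 := f p a2.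
have fK x y : f x (f x y) = y by case: fS.
have gK x y : g x (g x y) = y by case: gS.
have fE x y : (f p x == y) = (x == f p y) by rewrite (can2_eq (fK p) (fK p)).
have gE x y : (g p x == y) = (x == g p y) by rewrite (can2_eq (gK p) (gK p)).
have pf x : p != x -> p != f p x by rewrite [p == f p x]eq_sym (steiner_op_eql _ _ fS).
have pg x : p != x -> p != g p x by rewrite [p == g p x]eq_sym (steiner_op_eql _ _ gS).
have xf x : p != x -> x != f p x by rewrite [x == _]eq_sym (steiner_op_eqr _ _ fS).
have xg x : p != x -> x != g p x by rewrite [x == _]eq_sym (steiner_op_eqr _ _ gS).
have pa1 : p != a1 by apply: pf.
have pa2 : p != a2 by apply: pg.
have pa3 : p != a3 by apply: pf.
have a01 : a0 != a1 by apply: xf.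
have a12 : a1 != a2 by apply: xg.
have a23 : a2 != a3 by apply: xf.
have fa1 : f p a1 = a0 by apply: fK.
have a02 : a0 != a2 by rewrite -fa1 fg.
have a03 : a0 != a3 by rewrite -fE.
have a13 : a1 != a3 by rewrite -fE fa1.
have u5 : uniq [:: p; a0; a2; a1; a3].
  rewrite /= !inE !negb_or [a2 == a1]eq_sym.
  by rewrite pa0 pa1 pa2 pa3 a01 a02 a03 a12 a13 a23.
pose L := [:: p; a0; a2; a1; a3].
have [x xN] : exists x, x \notin L.
  apply/existsP; rewrite -negb_forall; apply/negP => /forallP all5.
  have /subset_leq_card : [set: V] \subset L by apply/subsetP=> y _; apply: all5.
  by rewrite cardsT V7 => /leq_trans/(_ (card_size _)).
have pN y : y \notin L -> p != y by rewrite inE eq_sym => /norP[].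
have fN y : y \notin L -> f p y \notin L.
  rewrite !inE !negb_or !fE -/a1 -/a3 fa1 [f p a3]fK.
  have -> : f p p = p by case: fS.
  by case/and5P => -> -> -> -> ->.
have uniq7 y : y \notin L -> uniq [:: f p y, y & L].
  move=> yN; rewrite cons_uniq inE negb_or fN // eq_sym xf ?pN //.
  by rewrite cons_uniq yN.
have mem7 y z : y \notin L -> z \in [:: f p y, y & L].
  move=> yN; apply: contraT => zN.
  have /card_uniqP h8 : uniq [:: z, f p y, y & L] by rewrite cons_uniq zN uniq7.
  by have := max_card (mem [:: z, f p y, y & L]); rewrite h8 V7.
have gN y : y \notin L -> (g p y == a0) || (g p y == a3).
  move=> yN; have py := pN y yN; have := mem7 _ (g p y) yN.
  have /negPf gf : g p y != f p y by rewrite eq_sym fg.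
  have /negPf gy : g p y != y by rewrite eq_sym xg.
  have /negPf gp : g p y != p by rewrite eq_sym pg.
  have ga2 : g p a2 = a1 by apply: gK.
  move: yN; rewrite !inE => /norP[_] /norP[_] /norP[/negPf y2] /norP[/negPf y1 _].
  by rewrite gf gy gp ![_ == a1]gE ![_ == a2]gE ga2 -/a2 y1 y2.
have gfN y : y \notin L -> g p y != g p (f p y).
  by move=> yN; rewrite (inj_eq (can_inj (gK p))) xf ?pN.
(* The cyclic walk [a0], [a1], [a2], [a3], [f p y], [y] is stored at the positions 1, 3, 2, 6, 4, 5
   of [s], the successive powers of 3. *)
have label y : y \notin L -> g p y = a0 -> exists2 c, bijective c & hexagon f g c.
  move=> yN gy; pose s := [:: p; a0; a2; a1; f p y; y; a3].
  have s_uniq : uniq s by rewrite (uniq_catCA [:: p; a0; a2; a1] [:: _; _]) uniq7.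
  have ga3 : g p a3 = f p y.
    apply/eqP; rewrite gE eq_sym; move: (gN _ (fN _ yN)) (gfN _ yN).
    by rewrite gy => /orP[/eqP->|//]; rewrite eqxx.
  exists (fun i : 'F_7 => nth p s i).
    apply: inj_card_bij; last by rewrite card_Fp // V7.
    by move=> i j /eqP; rewrite nth_uniq //= => /eqP/val_inj.
  by split; split=> //; apply: fK.
(* If [x] is not the neighbour of [a0], then [f p x] is. *)
have /orP[/eqP gx|/eqP gx] := gN _ xN; first exact: label xN gx.
apply: (label (f p x) (fN _ xN)); apply/eqP; move: (gN _ (fN _ xN)) (gfN _ xN).
by rewrite gx => /orP[//|/eqP->]; rewrite eqxx.
Qed.

(** * The two explicit operations on ['F_7] *)

Lemma F7_ind (P : 'F_7 -> Prop) :
  P 0 -> P 1 -> P 2 -> P 3 -> P 4 -> P 5 -> P 6 -> forall x, P x.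
Proof.
move=> P0 P1 P2 P3 P4 P5 P6 [[|[|[|[|[|[|[|m]]]]]]] hm] //.
- by have <- : 0 = Ordinal hm :> 'F_7 by apply/val_inj.
- by have <- : 1 = Ordinal hm :> 'F_7 by apply/val_inj.
- by have <- : 2 = Ordinal hm :> 'F_7 by apply/val_inj.
- by have <- : 3 = Ordinal hm :> 'F_7 by apply/val_inj.
- by have <- : 4 = Ordinal hm :> 'F_7 by apply/val_inj.
- by have <- : 5 = Ordinal hm :> 'F_7 by apply/val_inj.
- by have <- : 6 = Ordinal hm :> 'F_7 by apply/val_inj.
Qed.

(** As 4 is the inverse of 2, [4 * (x + y)] is the midpoint of [x] and [y]; [(x - y) ^+ 4] is
    [x - y] up to the sign given by the quadratic character. The blocks are the translates of {0, 1,
    3} here, and of {0, 2, 3} for [anti_fano_op]. *)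
Definition fano_op (x y : 'F_7) : 'F_7 := 4 * (x + y) - (x - y) ^+ 4.
Definition anti_fano_op (x y : 'F_7) : 'F_7 := 4 * (x + y) + (x - y) ^+ 4.

(** Affine maps of slope [a] with [a ^+ 3 = 1] respect both formulas because [a ^+ 4 = a] and
    [8 b = b]. *)
Lemma F21_fano_op (t : {perm 'F_7}) : t \in F21 <->
  (forall x y, t (fano_op x y) = fano_op (t x) (t y)) /\
  (forall x y, t (anti_fano_op x y) = anti_fano_op (t x) (t y)).
Proof.
split=> [/F21P[a [b [a3 tE]]]|[tf tg]].
  have a4 : a ^+ 4 = a by rewrite exprS a3 mulr1.
  have b8 : b = 4 * (b + b) by elim/F7_ind: b {tE} => //; apply/eqP.
  have h x y : (a * x + b - (a * y + b)) ^+ 4 = a * (x - y) ^+ 4.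
    by rewrite opprD addrACA subrr addr0 -mulrBr exprMn a4.
  have h' x y : 4 * (a * x + b + (a * y + b)) = a * (4 * (x + y)) + b.
    by rewrite addrACA mulrDr -b8 -mulrDr mulrCA.
  by split=> x y; rewrite !tE /fano_op /anti_fano_op h h' ?mulrBr ?(mulrDr a) addrAC.
(* Going round the hexagon computes every value of [t] from [t 0] and [t 1]; the block {1, 2, 4},
   which avoids 0, then constrains [t 1 - t 0]. *)
have t3 := tf 0 1; have t2 := tg 0 3; have t6 := tf 0 2; have t4 := tg 0 6.
have t5 := tf 0 4; have t4' := tf 1 2.
have e3 : fano_op 0 1 = 3 by apply/eqP.
have e2 : anti_fano_op 0 3 = 2 by apply/eqP.
have e6 : fano_op 0 2 = 6 by apply/eqP.
have e4 : anti_fano_op 0 6 = 4 by apply/eqP.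
have e5 : fano_op 0 4 = 5 by apply/eqP.
have e4' : fano_op 1 2 = 4 by apply/eqP.
rewrite e3 in t3; rewrite e2 t3 in t2; rewrite e6 t2 in t6.
rewrite e4 t6 in t4; rewrite e5 t4 in t5; rewrite e4' t4 t2 in t4'.
have t01 : t 0 != t 1 by rewrite (inj_eq perm_inj).
apply/F21P; exists (t 1 - t 0), (t 0).
suff [a3 [h2 h3 h4 h5 h6]] : (t 1 - t 0) ^+ 3 = 1 /\
  [/\ t 2 = (t 1 - t 0) * 2 + t 0, t 3 = (t 1 - t 0) * 3 + t 0,
      t 4 = (t 1 - t 0) * 4 + t 0, t 5 = (t 1 - t 0) * 5 + t 0
    & t 6 = (t 1 - t 0) * 6 + t 0].
  by split=> [|x]; last elim/F7_ind: x; rewrite ?mulr0 ?add0r ?mulr1 ?subrK.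
rewrite t2 t3 t4 t5 t6; move: t01 t4'; rewrite {t2 t3 t4 t5 t6 tf tg}.
move: (t 0) (t 1) => b e be /eqP h.
(* A closed boolean statement, evaluated at all 49 pairs. *)
suff : forall b e : 'F_7, b != e ->
  (let t3 := fano_op b e in let t2 := anti_fano_op b t3 in
  let t6 := fano_op b t2 in let t4 := anti_fano_op b t6 in
  let t5 := fano_op b t4 in (t4 == fano_op e t2) ==>
  [&& (e - b) ^+ 3 == 1, t2 == (e - b) * 2 + b, t3 == (e - b) * 3 + b,
     t4 == (e - b) * 4 + b, t5 == (e - b) * 5 + b & t6 == (e - b) * 6 + b])%R.
  move=> /(_ b e be)/implyP/(_ h)/and5P[/eqP h0 /eqP h2 /eqP h3 /eqP h4].
  by case/andP=> /eqP h5 /eqP h6; do !split; assumption.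
by elim/F7_ind; elim/F7_ind; vm_compute.
Qed.

(** * Uniqueness of the systems with a given hexagon *)

(* Proves that [f x y] takes one of the values allowed by the goal: any other
   value [v] gives [f x v = y] and [f y v = x], one of which contradicts the
   entries listed in [blocks]. *)
Ltac eliminate fS blocks f x y :=
  let h := fresh in
  move: (erefl (f x y)); move: {2}(f x y); elim/F7_ind => h;
  first [exact h | left; exact h | right; exact h | exfalso;
    case: (steiner_op_block fS h) => [[_ [+ _]] [+ _]]; rewrite ?blocks;
    first [by move/eqP | by move=> _ /eqP]].

(** The four given blocks force the other three, {1, 5, 6}, {2, 3, 5} and {3, 4, 6}, by
    elimination. *)
Lemma fano_op_unique (f : 'F_7 -> 'F_7 -> 'F_7) : steiner_op f ->
  f 0 1 = 3 -> f 0 2 = 6 -> f 0 4 = 5 -> f 1 2 = 4 -> f =2 fano_op.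
Proof.
move=> fS f01 f02 f04 f12.
have [fxx _ _] := fS; have B := steiner_op_block fS.
have K := (fxx, B _ _ _ f01, B _ _ _ f02, B _ _ _ f04, B _ _ _ f12).
have f15 : f 1 5 = 6 by eliminate fS K f (1 : 'F_7) (5 : 'F_7).
have f23 : f 2 3 = 5 by eliminate fS K f (2 : 'F_7) (3 : 'F_7).
have f34 : f 3 4 = 6 by eliminate fS K f (3 : 'F_7) (4 : 'F_7).
have K' := (K, B _ _ _ f15, B _ _ _ f23, B _ _ _ f34).
by elim/F7_ind; elim/F7_ind; rewrite K'; apply/eqP; vm_compute.
Qed.

(** Negation exchanges the two explicit operations, which reduces the claim to [fano_op_unique]. *)
Lemma anti_fano_op_unique (g : 'F_7 -> 'F_7 -> 'F_7) : steiner_op g ->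
  g 0 3 = 2 -> g 0 6 = 4 -> g 0 5 = 1 -> g 3 6 = 5 -> g =2 anti_fano_op.
Proof.
move=> gS g03 g06 g05 g36 x y.
have hS := steiner_op_conj (@opprK 'F_7) (@opprK 'F_7) gS.
have g65 : g 6 5 = 3 by rewrite (steiner_op_block gS g36).
have o0 : - 0 = 0 :> 'F_7 by rewrite oppr0.
have o1 : - 1 = 6 :> 'F_7 by apply/eqP.
have o2 : - 2 = 5 :> 'F_7 by apply/eqP.
have o4 : - 4 = 3 :> 'F_7 by apply/eqP.
have h01 : - g (- 0) (- 1) = 3 by rewrite o0 o1 g06.
have h02 : - g (- 0) (- 2) = 6 by rewrite o0 o2 g05.
have h04 : - g (- 0) (- 4) = 5 by rewrite o0 o4 g03.
have h12 : - g (- 1) (- 2) = 4 by rewrite o1 o2 g65 -o4 opprK.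
have := fano_op_unique hS h01 h02 h04 h12 (- x) (- y).
rewrite !opprK => /(canRL (@opprK _)) ->; rewrite /fano_op /anti_fano_op.
have -> : (- x - - y) ^+ 4 = (x - y) ^+ 4.
  by rewrite -opprD exprNn -signr_odd expr0 mul1r.
by rewrite -(opprD x y) mulrN opprB opprK addrC.
Qed.

(** The blocks through 0 leave only 4 and 5 as third point of the block through 1 and 2. If it is 5,
    the block through 3 and 5 is completed by 6; reversing the hexagon turns {3, 5, 6} into {1, 2,
    4}. *)
Lemma hexagon_orientation (f : 'F_7 -> 'F_7 -> 'F_7) : steiner_op f ->
  f 0 1 = 3 -> f 0 2 = 6 -> f 0 4 = 5 -> f 1 2 = 4 \/ f 3 5 = 6.
Proof.
move=> fS f01 f02 f04.
have [fxx _ _] := fS; have B := steiner_op_block fS.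
have K := (fxx, B _ _ _ f01, B _ _ _ f02, B _ _ _ f04).
have [f12|f12] : f 1 2 = 4 \/ f 1 2 = 5.
- by eliminate fS K f (1 : 'F_7) (2 : 'F_7).
- by left.
have K' := (K, B _ _ _ f12).
by right; eliminate fS K' f (3 : 'F_7) (5 : 'F_7).
Qed.

(** The only alternative, [g 3 6 = 1], would force {1, 2, 4} to be a block of both systems. *)
Lemma hexagon_opposite (f g : 'F_7 -> 'F_7 -> 'F_7) : steiner_op g ->
  (forall x y, x != y -> f x y != g x y) -> f 1 2 = 4 ->
  g 0 3 = 2 -> g 0 6 = 4 -> g 0 5 = 1 -> g 3 6 = 5.
Proof.
move=> gS fg f12 g03 g06 g05.
have [gxx _ _] := gS; have B := steiner_op_block gS.
have K := (gxx, B _ _ _ g03, B _ _ _ g06, B _ _ _ g05).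
have [g36|//] : g 3 6 = 1 \/ g 3 6 = 5.
  by eliminate gS K g (3 : 'F_7) (6 : 'F_7).
have K' := (K, B _ _ _ g36).
have g12 : g 1 2 = 4 by eliminate gS K' g (1 : 'F_7) (2 : 'F_7).
by have /eqP[] := fg 1 2 isT; rewrite f12 g12.
Qed.

Lemma orthogonal_fano_labelling (V : finType) (f g : V -> V -> V) :
  #|V| = 7%N -> steiner_op f -> steiner_op g ->
  (forall x y, x != y -> f x y != g x y) ->
  exists (c : 'F_7 -> V) (d : V -> 'F_7), [/\ cancel c d, cancel d c,
    forall x y, c (fano_op x y) = f (c x) (c y) &
    forall x y, c (anti_fano_op x y) = g (c x) (c y)].
Proof.
move=> V7 fS gS fg.
have [c [d cK dK] [[f01 f02 f04] [g03 g06 g05]]] :=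
    steiner_hexagon V7 fS gS fg.
(* The relation [f (c' 1) (c' 2) = c' 4] says that the hexagon is labelled in the right direction;
   both operations are then determined. *)
have labelled (c' : 'F_7 -> V) d' : cancel c' d' -> cancel d' c' ->
    hexagon f g c' -> f (c' 1) (c' 2) = c' 4 ->
    exists (c : 'F_7 -> V) (d : V -> 'F_7), [/\ cancel c d, cancel d c,
      forall x y, c (fano_op x y) = f (c x) (c y) &
      forall x y, c (anti_fano_op x y) = g (c x) (c y)].
  move=> c'K d'K [[f1 f2 f4] [g3 g6 g5]] f12; exists c', d'.
  pose f' x y := d' (f (c' x) (c' y)); pose g' x y := d' (g (c' x) (c' y)).
  have f'S : steiner_op f' := steiner_op_conj c'K d'K fS.
  have g'S : steiner_op g' := steiner_op_conj c'K d'K gS.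
  have fg' x y : x != y -> f' x y != g' x y.
    by move=> xy; rewrite (can_eq d'K) fg // (can_eq c'K).
  have f'12 : f' 1 2 = 4 by rewrite /f' f12 c'K.
  have g'03 : g' 0 3 = 2 by rewrite /g' g3 c'K.
  have g'06 : g' 0 6 = 4 by rewrite /g' g6 c'K.
  have g'05 : g' 0 5 = 1 by rewrite /g' g5 c'K.
  have f'E : f' =2 fano_op.
    by apply: fano_op_unique; rewrite // /f' ?f1 ?f2 ?f4 c'K.
  have g'E : g' =2 anti_fano_op.
    apply: anti_fano_op_unique => //.
    exact: hexagon_opposite g'S fg' f'12 g'03 g'06 g'05.
  by split=> // x y; rewrite -?f'E -?g'E d'K.
pose f' x y := d (f (c x) (c y)).
have [|||f12|f35] := @hexagon_orientation f' (steiner_op_conj cK dK fS).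
- by rewrite /f' f01.
- by rewrite /f' f02.
- by rewrite /f' f04.
- by apply: (labelled c d) => //; rewrite -f12 dK.
(* [x |-> 3 / x] maps [3 ^ i] to [3 ^ (1 - i)]: it reverses the hexagon. *)
pose r (x : 'F_7) : 'F_7 := 3 * x ^+ 5.
have rK : involutive r by elim/F7_ind; apply/eqP; vm_compute.
have r0 : r 0 = 0 by apply/eqP; vm_compute.
have r1 : r 1 = 3 by apply/eqP; vm_compute.
have r2 : r 2 = 5 by apply/eqP; vm_compute.
have r4 : r 4 = 6 by apply/eqP; vm_compute.
have r3 : r 3 = 1 by apply/eqP; vm_compute.
have r5 : r 5 = 2 by apply/eqP; vm_compute.
have r6 : r 6 = 4 by apply/eqP; vm_compute.
have fB := steiner_op_block fS; have gB := steiner_op_block gS.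
(* Since [r] fixes 0 and swaps 1 with 3, 2 with 5 and 4 with 6, it preserves both pairings around 0
   and turns [f35] into the relation wanted by [labelled]. *)
apply: (labelled (c \o r) (r \o d)); rewrite /hexagon /= ?r0 ?r1 ?r2 ?r3 ?r4 ?r5 ?r6.
- exact: can_comp.
- exact: can_comp.
- split; split; first [by rewrite (fB _ _ _ f01) | by rewrite (fB _ _ _ f02)
    | by rewrite (fB _ _ _ f04) | by rewrite (gB _ _ _ g03)
    | by rewrite (gB _ _ _ g06) | by rewrite (gB _ _ _ g05)].
- by rewrite -f35 dK.
Qed.

(** * From the labelling to the group isomorphism *)

(** Conjugation by [c] is an injective morphism on the full symmetric group, and the last hypothesis
    says that it matches [G] with [H]. *)
Lemma isog_perm_conj (T U : finType) (c : T -> U) (d : U -> T)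
    (G : {group {perm U}}) (H : {group {perm T}}) :
  cancel c d -> cancel d c ->
  (forall (s : {perm U}) (t : {perm T}),
     (forall x, s (c x) = c (t x)) -> (s \in G) = (t \in H)) ->
  G \isog H.
Proof.
move=> cK dK GH.
have inj (s : {perm U}) : injective (fun x => d (s (c x))).
  exact: inj_comp (can_inj dK) (inj_comp perm_inj (can_inj cK)).
pose phi s := perm (inj s).
have phiE (s : {perm U}) x : s (c x) = c (phi s x) by rewrite permE dK.
have phiM : {in setT &, {morph phi : s t / (s * t)%g}}.
  by move=> s t _ _; apply/permP=> x; rewrite !(permE, permM) dK.
pose phim := Morphism phiM.
have phi_inj : ('injm phim)%g.
  apply/injmP=> s t _ _ /permP st; apply/permP=> y.
  by rewrite -(dK y) !phiE [phi s _]st.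
suff <- : (phim @* G)%g = H by apply: sub_isog; rewrite ?subsetT.
apply/setP=> t; apply/morphimP/idP => [[s _ sG ->] | tH].
  by rewrite -(GH s) // => x; apply: phiE.
have inj' : injective (fun y => c (t (d y))).
  exact: inj_comp (can_inj cK) (inj_comp perm_inj (can_inj dK)).
have sE x : perm inj' (c x) = c (t x) by rewrite permE cK.
exists (perm inj'); rewrite ?inE //; first by rewrite (GH _ t).
by apply/permP=> x; rewrite permE sE cK.
Qed.

Theorem theorem2p3 (V : finType) (F S : {set {set V}}) :
  fano_plane F -> fano_plane S -> orthogonal_sts F S ->
  (sts_aut F :&: sts_aut S)%g \isog F21.
Proof.
move=> hF hS [FS _]; have [V7 _ _] := hF.
have [f [fS fT]] := sts_third_point hF; have [g [gS gT]] := sts_third_point hS.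
have fg x y : x != y -> f x y != g x y.
  move=> xy; rewrite -(gT _ _ _ xy); apply/negP=> xyS.
  have : [set x; y; f x y] \in F :&: S by rewrite inE xyS fT ?eqxx.
  by rewrite FS inE.
have [c [d [cK dK cf cg]]] := orthogonal_fano_labelling V7 fS gS fg.
(* Here [t] is [s] read through the labels, so [s] respects [f] and [g] exactly when [t] respects
   [fano_op] and [anti_fano_op]. *)
apply: (isog_perm_conj cK dK) => s t st; apply/idP/idP.
  rewrite inE => /andP[/(sts_aut_third_point _ hF fS fT) sf].
  move=> /(sts_aut_third_point _ hS gS gT) sg.
  by apply/F21_fano_op; split=> x y; apply: (can_inj cK);
    rewrite -st ?cf ?cg ?sf ?sg !st.
case/F21_fano_op=> tf tg; rewrite inE; apply/andP; split.
  apply/(sts_aut_third_point _ hF fS fT) => x y.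
  by rewrite -(dK x) -(dK y) -cf !st tf cf.
apply/(sts_aut_third_point _ hS gS gT) => x y.
by rewrite -(dK x) -(dK y) -cg !st tg cg.
Qed.
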